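(* Let $\{w^k\}$, $w^k=(x^k,y^k,\lambda^k)$, be a sequence generated by the iPSPR iteration with $(\alpha,\gamma)\in\mathbb D_2\cup\mathbb D_3\cup\mathbb D_4$ and symmetric (possibly indefinite) proximal matrices $S,T$. Suppose that $$S+\tfrac12\Sigma_1\succeq 0,\qquad S+\tfrac12\Sigma_1+\beta A^{\mathsf T}A\succ 0,\qquad S+\tfrac12\Sigma_1\succeq\tfrac12 c\,\Sigma_1\ \text{ for some constant } c>0,$$ and $$T+\Sigma_2+(1-\alpha)\beta B^{\mathsf T}B\succ 0,\qquad T+\tfrac12\Sigma_2+\kappa_1^{\alpha,\gamma}(-2T_-+\Sigma_2)+\kappa_2^{\alpha,\gamma}\beta B^{\mathsf T}B\succ 0,$$ $$T+\tfrac12\Sigma_2+\frac{(1-\alpha)(1-\gamma)}{2-\alpha-\gamma}\beta B^{\mathsf T}B\succeq 0.$$ Then, as $t\to\infty$, $$\|w^t-w^{t+1}\|_{\widehat G}^2=o(1/t).$$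
   Context: **Problem.** $\min\ \theta_1(x)+\theta_2(y)$ s.t. $Ax+By=b$, $x\in\mathcal X=\mathbb R^{n_1}$, $y\in\mathcal Y=\mathbb R^{n_2}$, with $A\in\mathbb R^{m\times n_1}$, $B\in\mathbb R^{m\times n_2}$, $b\in\mathbb R^m$. Here $\theta_1=p+f$, $\theta_2=h+g$, where $p:\mathcal X\to(-\infty,+\infty]$, $h:\mathcal Y\to(-\infty,+\infty]$ are proper closed convex and $f:\mathcal X\to\mathbb R$, $g:\mathcal Y\to\mathbb R$ are convex with Lipschitz continuous gradients. Let $\Omega=\mathcal X\times\mathcal Y\times\mathbb R^m$, $w=(x,y,\lambda)$. $\Omega^*$ is the set of primal-dual optimal solutions: $w^*=(x^*,y^*,\lambda^* )$ with $Ax^*+By^*=b$, $A^{\mathsf T}\lambda^*\in\partial\theta_1(x^* )$, $B^{\mathsf T}\lambda^*\in\partial\theta_2(y^* )$. It is assumed that $\Omega^*\neq\emptyset$. **Convexity matrices.** $\Sigma_1,\Sigma_2$ are fixed symmetric positive semidefinite matrices with $\langle x-x',\xi_x-\xi_x'\rangle\ge\|x-x'\|_{\Sigma_1}^2$ for all $x,x'$, $\xi_x\in\partial\theta_1(x)$, $\xi_x'\in\partial\theta_1(x')$, and $\langle y-y',\xi_y-\xi_y'\rangle\ge\|y-y'\|_{\Sigma_2}^2$ for all $y,y'$, $\xi_y\in\partial\theta_2(y)$, $\xi_y'\in\partial\theta_2(y')$. For symmetric (possibly indefinite) $G$, $\|z\|_G^2:=z^{\mathsf T}Gz$. **iPSPR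 iteration.** Let $\beta>0$ and $\mathcal L_\beta(x,y,\lambda)=\theta_1(x)+\theta_2(y)-\langle\lambda,Ax+By-b\rangle+\frac\beta2\|Ax+By-b\|^2$. Given $w^0\in\Omega$, for $k\ge 0$: $x^{k+1}=\arg\min_{x\in\mathcal X}\mathcal L_\beta(x,y^k,\lambda^k)+\frac12\|x-x^k\|_S^2$; $\lambda^{k+1/2}=\lambda^k-\alpha\beta(Ax^{k+1}+By^k-b)$; $y^{k+1}=\arg\min_{y\in\mathcal Y}\mathcal L_\beta(x^{k+1},y,\lambda^{k+1/2})+\frac12\|y-y^k\|_T^2$; $\lambda^{k+1}=\lambda^{k+1/2}-\gamma\beta(Ax^{k+1}+By^{k+1}-b)$. $S,T$ are symmetric; $T=T_+-T_-$ is a fixed decomposition with $T_+\succeq0$, $T_-\succeq0$. **Matrix $\widehat G$.** $$\widehat G=\begin{pmatrix}S+\Sigma_1&0&0\\0&T+\Sigma_2+\frac{\alpha+\gamma-\alpha\gamma}{\alpha+\gamma}\beta B^{\mathsf T}B&-\frac{\alpha}{\alpha+\gamma}B^{\mathsf T}\\0&-\frac{\alpha}{\alpha+\gamma}B&\frac1{(\alpha+\gamma)\beta}I_m\end{pmatrix}.$$ **Stepsize sets.** $\mathbb D_2=\{(\alpha,\gamma):0\le\alpha<1,\gamma=1\}$, $\mathbb D_3=\{(\alpha,\gamma):0\le\alpha<1,0\le\gamma<1,\alpha+\gamma>0,\alpha\ne\gamma\}$, $\mathbb D_4=\{(\alpha,\gamma):0<\alpha=\gamma<1\}$. **Constants.**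 $c^{\alpha,\gamma}$ is a fixed number in $(0,1)$ if $(\alpha,\gamma)\in\mathbb D_2\cup\mathbb D_3$ (not needed on $\mathbb D_4$). $\kappa_1^{\alpha,\gamma}=\frac{1-\alpha}{1+\alpha}$ on $\mathbb D_2$, $0$ on $\mathbb D_3\cup\mathbb D_4$. $\kappa_2^{\alpha,\gamma}=\frac{c^{\alpha,\gamma}(1-\alpha)(3-\alpha)}{4(1+\alpha)}$ on $\mathbb D_2$, $\frac{c^{\alpha,\gamma}(1-\alpha)(1-\gamma)}{2-\gamma-\alpha}$ on $\mathbb D_3$, $\frac{1-\alpha}2$ on $\mathbb D_4$. *)

(* Defs.v *)
From mathcomp Require Import all_boot all_order all_algebra.
From mathcomp Require Import all_classical all_reals all_analysis.

Set Implicit Arguments.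
Unset Strict Implicit.
Unset Printing Implicit Defensive.

Import Order.TTheory GRing.Theory Num.Theory.
Import numFieldNormedType.Exports.

Local Open Scope classical_set_scope.
Local Open Scope ring_scope.

(** * Vectors and quadratic forms *)

Definition dotv (R : realType) (n : nat) (u v : 'cV[R]_n) : R :=
  (u^T *m v) 0 0.

(* This is ||z||_G^2; G may be indefinite. *)
Definition qform (R : realType) (n : nat) (G : 'M[R]_n) (z : 'cV[R]_n) : R :=
  (z^T *m G *m z) 0 0.

Definition symmx (R : realType) (n : nat) (M : 'M[R]_n) : Prop := M^T = M.

Definition psdmx (R : realType) (n : nat) (M : 'M[R]_n) : Prop :=
  symmx M /\ forall z, 0 <= qform M z.

Definition pdmx (R : realType) (n : nat) (M : 'M[R]_n) : Prop :=
  symmx M /\ forall z, z != 0 -> 0 < qform M z.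

(** * Convex analysis *)

Definition proper_fun (R : realType) (n : nat) (p : 'cV[R]_n -> \bar R) :
  Prop := (forall x, p x != -oo%E) /\ exists x, p x \is a fin_num.

Definition convex_efun (R : realType) (n : nat) (p : 'cV[R]_n -> \bar R) :
  Prop :=
  forall (x y : 'cV[R]_n) (t : R), 0 < t < 1 ->
    (p (t *: x + (1 - t) *: y)%R <= t%:E * p x + (1 - t)%:E * p y)%E.

(* For a proper convex function, closed means lower semicontinuous. *)
Definition proper_closed_convex (R : realType) (n : nat)
    (p : 'cV[R]_n -> \bar R) : Prop :=
  [/\ proper_fun p, lower_semicontinuous p & convex_efun p].

Definition grad (R : realType) (n : nat) (f : 'cV[R]_n -> R) (x : 'cV[R]_n) :
  'cV[R]_n := \col_i 'd f x (delta_mx i 0 : 'cV[R]_n).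

(* [lipschitz] uses the sup norm that MathComp-Analysis puts on matrices; only
   the existence of a Lipschitz constant is asserted, so this agrees with the
   Euclidean norm. *)
Definition convex_lipschitz_grad (R : realType) (n : nat)
    (f : 'cV[R]_n -> R) : Prop :=
  [/\ convex_function setT f,
      forall x, differentiable f x
    & lipschitz (grad f)].

(* Where a proper theta is +oo this set is empty, as it should be. *)
Definition subdiff (R : realType) (n : nat) (theta : 'cV[R]_n -> \bar R)
    (x : 'cV[R]_n) : set 'cV[R]_n :=
  [set xi | forall z, (theta x + (dotv xi (z - x))%:E <= theta z)%E].

Definition convexity_mx (R : realType) (n : nat) (theta : 'cV[R]_n -> \bar R)
    (Sigma : 'M[R]_n) : Prop :=
  psdmx Sigma /\
  forall x x' xi xi' : 'cV[R]_n, subdiff theta x xi -> subdiff theta x' xi' ->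
    qform Sigma (x - x') <= dotv (x - x') (xi - xi').

Definition argmin (R : realType) (n : nat) (F : 'cV[R]_n -> \bar R) :
  set 'cV[R]_n := [set x | forall z, (F x <= F z)%E].

(** * The problem min theta1 x + theta2 y subject to A x + B y = b *)

Definition composite (R : realType) (n : nat) (p : 'cV[R]_n -> \bar R)
    (f : 'cV[R]_n -> R) (x : 'cV[R]_n) : \bar R := (p x + (f x)%:E)%E.

Definition residual (R : realType) (n1 n2 m : nat) (A : 'M[R]_(m, n1))
    (B : 'M[R]_(m, n2)) (b : 'cV[R]_m) (x : 'cV[R]_n1) (y : 'cV[R]_n2) :
  'cV[R]_m := A *m x + B *m y - b.

Definition primal_dual_optimal (R : realType) (n1 n2 m : nat)
    (theta1 : 'cV[R]_n1 -> \bar R) (theta2 : 'cV[R]_n2 -> \bar R)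
    (A : 'M[R]_(m, n1)) (B : 'M[R]_(m, n2)) (b : 'cV[R]_m)
    (x : 'cV[R]_n1) (y : 'cV[R]_n2) (l : 'cV[R]_m) : Prop :=
  [/\ A *m x + B *m y = b,
      subdiff theta1 x (A^T *m l)
    & subdiff theta2 y (B^T *m l)].

(* Terms of the augmented Lagrangian other than theta1 x + theta2 y. *)
Definition coupling (R : realType) (n1 n2 m : nat) (A : 'M[R]_(m, n1))
    (B : 'M[R]_(m, n2)) (b : 'cV[R]_m) (beta : R)
    (x : 'cV[R]_n1) (y : 'cV[R]_n2) (l : 'cV[R]_m) : R :=
  - dotv l (residual A B b x y)
  + beta / 2 * dotv (residual A B b x y) (residual A B b x y).

Definition auglag (R : realType) (n1 n2 m : nat)
    (theta1 : 'cV[R]_n1 -> \bar R) (theta2 : 'cV[R]_n2 -> \bar R)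
    (A : 'M[R]_(m, n1)) (B : 'M[R]_(m, n2)) (b : 'cV[R]_m) (beta : R)
    (x : 'cV[R]_n1) (y : 'cV[R]_n2) (l : 'cV[R]_m) : \bar R :=
  (theta1 x + theta2 y + (coupling A B b beta x y l)%:E)%E.

(** * The iteration *)

(* In each subproblem the term of the augmented Lagrangian that does not depend
   on the unknown (theta2 y^k, resp. theta1 x^{k+1}) is left out.  When it is
   finite this changes nothing, see [argmin_auglag_x] and [argmin_auglag_y];
   it can be infinite only for y^0, which is arbitrary, and then the objective
   with that term is identically +oo. *)
Definition x_objective (R : realType) (n1 n2 m : nat)
    (theta1 : 'cV[R]_n1 -> \bar R)
    (A : 'M[R]_(m, n1)) (B : 'M[R]_(m, n2)) (b : 'cV[R]_m) (beta : R)
    (S : 'M[R]_n1) (xk : 'cV[R]_n1) (y : 'cV[R]_n2) (l : 'cV[R]_m)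
    (x : 'cV[R]_n1) : \bar R :=
  (theta1 x + (coupling A B b beta x y l + 2^-1 * qform S (x - xk))%:E)%E.

Definition y_objective (R : realType) (n1 n2 m : nat)
    (theta2 : 'cV[R]_n2 -> \bar R)
    (A : 'M[R]_(m, n1)) (B : 'M[R]_(m, n2)) (b : 'cV[R]_m) (beta : R)
    (T : 'M[R]_n2) (yk : 'cV[R]_n2) (x : 'cV[R]_n1) (l : 'cV[R]_m)
    (y : 'cV[R]_n2) : \bar R :=
  (theta2 y + (coupling A B b beta x y l + 2^-1 * qform T (y - yk))%:E)%E.

Lemma argmin_auglag_x (R : realType) (n1 n2 m : nat)
    (theta1 : 'cV[R]_n1 -> \bar R) (theta2 : 'cV[R]_n2 -> \bar R)
    (A : 'M[R]_(m, n1)) (B : 'M[R]_(m, n2)) (b : 'cV[R]_m) (beta : R)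
    (S : 'M[R]_n1) (xk : 'cV[R]_n1) (y : 'cV[R]_n2) (l : 'cV[R]_m) :
  theta2 y \is a fin_num ->
  argmin (fun x => auglag theta1 theta2 A B b beta x y l
                   + (2^-1 * qform S (x - xk))%:E)%E
  = argmin (x_objective theta1 A B b beta S xk y l).
Proof.
move=> fin2; have E x : (auglag theta1 theta2 A B b beta x y l
    + (2^-1 * qform S (x - xk))%:E
    = x_objective theta1 A B b beta S xk y l x + theta2 y)%E.
  rewrite /auglag /x_objective (EFinD (coupling _ _ _ _ _ _ _)).
  by rewrite -(addeA (theta1 x + _)%E) addeAC.
by apply/seteqP; split=> x /= minx z; move: (minx z); rewrite !E leeD2rE.
Qed.

Lemma argmin_auglag_y (R : realType) (n1 n2 m : nat)
    (theta1 : 'cV[R]_n1 -> \bar R) (theta2 : 'cV[R]_n2 -> \bar R)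
    (A : 'M[R]_(m, n1)) (B : 'M[R]_(m, n2)) (b : 'cV[R]_m) (beta : R)
    (T : 'M[R]_n2) (yk : 'cV[R]_n2) (x : 'cV[R]_n1) (l : 'cV[R]_m) :
  theta1 x \is a fin_num ->
  argmin (fun y => auglag theta1 theta2 A B b beta x y l
                   + (2^-1 * qform T (y - yk))%:E)%E
  = argmin (y_objective theta2 A B b beta T yk x l).
Proof.
move=> fin1; have E y : (auglag theta1 theta2 A B b beta x y l
    + (2^-1 * qform T (y - yk))%:E
    = y_objective theta2 A B b beta T yk x l y + theta1 x)%E.
  rewrite /auglag /y_objective (EFinD (coupling _ _ _ _ _ _ _)).
  by rewrite -(addeA (theta1 x + _)%E)
    (addeC (theta1 x)) addeAC.
by apply/seteqP; split=> y /= miny z; move: (miny z); rewrite !E leeD2rE.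
Qed.

Definition iPSPR (R : realType) (n1 n2 m : nat)
    (theta1 : 'cV[R]_n1 -> \bar R) (theta2 : 'cV[R]_n2 -> \bar R)
    (A : 'M[R]_(m, n1)) (B : 'M[R]_(m, n2)) (b : 'cV[R]_m)
    (beta alpha gamma : R) (S : 'M[R]_n1) (T : 'M[R]_n2)
    (x : nat -> 'cV[R]_n1) (y : nat -> 'cV[R]_n2) (l : nat -> 'cV[R]_m) :
  Prop :=
  forall k : nat,
    let lhalf := l k - (alpha * beta) *: residual A B b (x k.+1) (y k) in
    [/\ argmin (x_objective theta1 A B b beta S (x k) (y k) (l k)) (x k.+1),
        argmin (y_objective theta2 A B b beta T (y k) (x k.+1) lhalf) (y k.+1)
      & l k.+1 = lhalf - (gamma * beta) *: residual A B b (x k.+1) (y k.+1)].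

(** * Stepsizes, constants and the matrix Ghat *)

Definition D2 (R : realType) (alpha gamma : R) : bool :=
  (0 <= alpha < 1) && (gamma == 1).

Definition D3 (R : realType) (alpha gamma : R) : bool :=
  [&& 0 <= alpha < 1, 0 <= gamma < 1, 0 < alpha + gamma & alpha != gamma].

Definition D4 (R : realType) (alpha gamma : R) : bool :=
  (0 < alpha < 1) && (alpha == gamma).

Definition kappa1 (R : realType) (alpha gamma : R) : R :=
  if D2 alpha gamma then (1 - alpha) / (1 + alpha) else 0.

(* cag stands for c^{alpha,gamma}; the last branch is the case D4. *)
Definition kappa2 (R : realType) (cag alpha gamma : R) : R :=
  if D2 alpha gamma then
    cag * (1 - alpha) * (3 - alpha) / (4 * (1 + alpha))
  else if D3 alpha gamma then
    cag * (1 - alpha) * (1 - gamma) / (2 - gamma - alpha)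
  else (1 - alpha) / 2.

Definition Ghat (R : realType) (n1 n2 m : nat) (B : 'M[R]_(m, n2))
    (beta alpha gamma : R) (S Sigma1 : 'M[R]_n1) (T Sigma2 : 'M[R]_n2) :
  'M[R]_(n1 + (n2 + m)) :=
  block_mx (S + Sigma1) 0 0
    (block_mx
       (T + Sigma2
        + ((alpha + gamma - alpha * gamma) / (alpha + gamma) * beta)
          *: (B^T *m B))
       (- (alpha / (alpha + gamma)) *: B^T)
       (- (alpha / (alpha + gamma)) *: B)
       (((alpha + gamma) * beta)^-1)%:M).

Definition stack (R : realType) (n1 n2 m : nat)
    (x : 'cV[R]_n1) (y : 'cV[R]_n2) (l : 'cV[R]_m) : 'cV[R]_(n1 + (n2 + m)) :=
  col_mx x (col_mx y l).

(* Main.v *)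
Require Import Defs.
From mathcomp Require Import all_boot all_order all_algebra.
From mathcomp Require Import all_classical all_reals all_analysis.
From mathcomp Require Import ring lra.

Set Implicit Arguments.
Unset Strict Implicit.
Unset Printing Implicit Defensive.

Import Order.TTheory GRing.Theory Num.Theory.
Import numFieldNormedType.Exports.

Local Open Scope classical_set_scope.
Local Open Scope ring_scope.

(** The rate o(1/t) comes from two properties of the squared step lengths
    a_t = ||w^t - w^{t+1}||^2 in the seminorm of Ghat: the sequence decreases,
    and it is summable (lemma [dissipation_littleo]).

    Both follow from one inequality.  The first-order conditions of the two
    subproblems turn an iteration into a pair of subgradient inclusions plus
    affine updates of the multiplier ([prox_step]).  If two such steps are run
    side by side, the difference e of their states satisfies, by monotonicity
    of the subdifferentials,

      ||e||^2 - ||e'||^2 >= ||dx||^2_{S + Sigma1/2} + ||dy||^2_{T + Sigma2/2}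
          + beta ((1-alpha) |d|^2 + 2 (1-alpha) <r, d> + (2-alpha-gamma) |r|^2)

    where dx, dy are the increments of e, d = B dy and r is the difference of
    the new residuals ([prox_step_decrease]).  The computation becomes short
    once the multiplier l is replaced by z = l - alpha beta B y: this
    diagonalises Ghat ([qform_Ghat]) and the update becomes
    z' = z - (alpha+gamma) beta r.

    Comparing the step k with the step k+1, e is the k-th increment of w, and
    minimising the bracket over r leaves (1-alpha)(1-gamma)/(2-alpha-gamma)
    |d|^2, so the hypotheses make the right-hand side nonnegative: a_t
    decreases.  Comparing the step k with a primal-dual solution, which is a
    fixed point, the energy ||w^k - w*||^2 decreases by at least the right-hand
    side; it remains to see that this controls a_k.  When gamma < 1 the bracket
    is a positive definite form in (d, r) and this is direct.  When gamma = 1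
    it degenerates to (1-alpha) |r + d|^2.  Then part of the term <r, d> is
    bounded below by comparing the y-subgradients of two consecutive
    iterations ([prox_step_cross_lb]); the price is a telescoping term in
    T_+ + T_- and the matrix -2 T_- + Sigma2 weighted by kappa1.  In all cases
    [stepsize_coercive] leaves kappa2 |d|^2 plus a positive multiple of a square
    |r + sigma d|^2.  The resulting positive definite matrix in dy dominates
    every other quadratic form ([pdmx_dom]), hence also a_k
    ([energy_controlled]). *)

(** * Inner products and quadratic forms *)

Section Dotv.
Context {R : realType}.

Lemma dotvE n (u v : 'cV[R]_n) : dotv u v = \sum_i u i 0 * v i 0.
Proof. by rewrite /dotv mxE; apply: eq_bigr => i _; rewrite mxE. Qed.

Lemma dotvC n (u v : 'cV[R]_n) : dotv u v = dotv v u.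
Proof. by rewrite !dotvE; apply: eq_bigr => i _; rewrite mulrC. Qed.

Lemma dotvDl n (u v w : 'cV[R]_n) : dotv (u + v) w = dotv u w + dotv v w.
Proof. by rewrite /dotv linearD mulmxDl mxE. Qed.

Lemma dotvNl n (u w : 'cV[R]_n) : dotv (- u) w = - dotv u w.
Proof. by rewrite /dotv linearN mulNmx mxE. Qed.

Lemma dotvZl n a (u w : 'cV[R]_n) : dotv (a *: u) w = a * dotv u w.
Proof. by rewrite /dotv linearZ -scalemxAl mxE. Qed.

Lemma dotvDr n (u v w : 'cV[R]_n) : dotv w (u + v) = dotv w u + dotv w v.
Proof. by rewrite /dotv mulmxDr mxE. Qed.

Lemma dotvNr n (u w : 'cV[R]_n) : dotv w (- u) = - dotv w u.
Proof. by rewrite /dotv mulmxN mxE. Qed.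

Lemma dotvZr n a (u w : 'cV[R]_n) : dotv w (a *: u) = a * dotv w u.
Proof. by rewrite /dotv -scalemxAr mxE. Qed.

Definition dotv_lin := (dotvDl, dotvDr, dotvNl, dotvNr, dotvZl, dotvZr).

Lemma dotv_mulmx m n (A : 'M[R]_(m, n)) u v :
  dotv u (A *m v) = dotv (A^T *m u) v.
Proof. by rewrite /dotv trmx_mul trmxK mulmxA. Qed.

Lemma dotv_symm n (M : 'M[R]_n) u v :
  symmx M -> dotv u (M *m v) = dotv v (M *m u).
Proof. by move=> sM; rewrite dotv_mulmx sM dotvC. Qed.

Lemma dotvv_ge0 n (u : 'cV[R]_n) : 0 <= dotv u u.
Proof. by rewrite dotvE sumr_ge0 // => i _; rewrite -expr2 sqr_ge0. Qed.

Lemma qformE n (M : 'M[R]_n) z : qform M z = dotv z (M *m z).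
Proof. by rewrite /qform /dotv mulmxA. Qed.

Lemma qformDl n (M N : 'M[R]_n) z : qform (M + N) z = qform M z + qform N z.
Proof. by rewrite !qformE mulmxDl dotvDr. Qed.

Lemma qformNl n (M : 'M[R]_n) z : qform (- M) z = - qform M z.
Proof. by rewrite !qformE mulNmx dotvNr. Qed.

Lemma qformZl n a (M : 'M[R]_n) z : qform (a *: M) z = a * qform M z.
Proof. by rewrite !qformE -scalemxAl dotvZr. Qed.

Lemma qform_gram m n (B : 'M[R]_(m, n)) z :
  qform (B^T *m B) z = dotv (B *m z) (B *m z).
Proof. by rewrite qformE -mulmxA dotv_mulmx trmxK. Qed.

Definition qform_lin := (qformDl, qformNl, qformZl, qform_gram).

Lemma qformN n (M : 'M[R]_n) z : qform M (- z) = qform M z.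
Proof. by rewrite !qformE mulmxN !dotv_lin opprK. Qed.

Lemma qformD n (M : 'M[R]_n) u v : symmx M ->
  qform M (u + v) = qform M u + 2 * dotv u (M *m v) + qform M v.
Proof.
by move=> sM; rewrite !qformE mulmxDr !dotv_lin (dotv_symm v u) //; ring.
Qed.

Lemma qformZ n (M : 'M[R]_n) a z : qform M (a *: z) = a ^+ 2 * qform M z.
Proof. by rewrite !qformE -scalemxAr !dotv_lin; ring. Qed.

Lemma pdmx_ge0 n (M : 'M[R]_n) z : pdmx M -> 0 <= qform M z.
Proof.
move=> [_ pM]; have [->|/pM/ltW //] := eqVneq z 0.
by rewrite qformE mulmx0 dotvE sumr_ge0 // => i _; rewrite mxE mulr0.
Qed.

Lemma pdmx_unit n (M : 'M[R]_n) : pdmx M -> M \in unitmx.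
Proof.
move=> [sM pM]; rewrite -row_free_unit -kermx_eq0; apply/eqP/row_matrixP => i.
rewrite row0; apply/eqP; apply: contraT => nz.
have := pM (row i (kermx M))^T.
rewrite trmx_eq0 => /(_ nz); rewrite /qform trmxK.
by rewrite -row_mul mulmx_ker row0 mul0mx mxE ltxx.
Qed.

(** Cauchy-Schwarz for the inner product of M, applied to M^-1 u and z. *)
Lemma pdmx_dom_dotv n (M : 'M[R]_n) (u : 'cV[R]_n) : pdmx M ->
  exists2 C : R, 0 <= C & forall z, dotv u z ^+ 2 <= C * qform M z.
Proof.
move=> pM; have uM := pdmx_unit pM; have [sM _] := pM.
pose w := invmx M *m u.
have Mw : M *m w = u by rewrite /w mulKVmx.
have ge0 z : 0 <= qform M z by exact: pdmx_ge0.
exists (qform M w + 1) => [|z]; first by rewrite addr_ge0.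
set q := qform M w; have q1 : 0 < q + 1 by rewrite ltr_wpDl // /q ge0.
(* Adding 1 to q keeps the multiple of w well defined when u = 0; the multiple
   is not optimal, but only the existence of C matters. *)
have := ge0 (z - ((q + 1)^-1 * dotv u z) *: w).
rewrite qformD // mulmxN -scalemxAr Mw qformN qformZ !dotv_lin -/q.
rewrite (dotvC z u); set d := dotv u z; set e := qform M z.
move=> H; have {}H : 0 <= (q + 1) ^+ 2 *
   (e + 2 * - ((q + 1)^-1 * d * d) + ((q + 1)^-1 * d) ^+ 2 * q).
  by rewrite mulr_ge0 // sqr_ge0.
have E : (q + 1) ^+ 2 *
   (e + 2 * - ((q + 1)^-1 * d * d) + ((q + 1)^-1 * d) ^+ 2 * q)
   = (q + 1) * ((q + 1) * e - d ^+ 2) - d ^+ 2.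
  by field; rewrite gt_eqF.
rewrite E in H.
have : 0 <= (q + 1) * ((q + 1) * e - d ^+ 2).
  by move: (sqr_ge0 d); lra.
by rewrite pmulr_rge0 // subr_ge0.
Qed.

(** The squared coordinates of z are dominated by M, since each of them is an
    inner product with a fixed vector; hence so is any quadratic form. *)
Lemma pdmx_dom n (M N : 'M[R]_n) : pdmx M ->
  exists2 C : R, 0 <= C & forall z, qform N z <= C * qform M z.
Proof.
move=> pM.
have [c c0 cP] : exists2 c : R, 0 <= c &
    forall i z, (z : 'cV[R]_n) i 0 ^+ 2 <= c * qform M z.
  have /choice [c cP] (i : 'I_n) : exists c : R, 0 <= c /\
     forall z, (z : 'cV[R]_n) i 0 ^+ 2 <= c * qform M z.
    have [c c0 cP] := pdmx_dom_dotv (delta_mx i 0) pM.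
    exists c; split=> // z; have := cP z.
    rewrite dotvE (bigD1 i) //= big1 ?addr0 => [|j ji].
      by rewrite mxE !eqxx mul1r.
    by rewrite mxE (negPf ji) mul0r.
  exists (\sum_i c i) => [|i z]; first by apply: sumr_ge0 => i _; have [] := cP i.
  have M0 : 0 <= qform M z by exact: pdmx_ge0.
  have [_ /(_ z) /le_trans] := cP i; apply.
  rewrite ler_wpM2r // (bigD1 i) //= lerDl.
  by apply: sumr_ge0 => j _; have [] := cP j.
exists (\sum_i \sum_j `|N i j| * c) => [|z].
  by apply: sumr_ge0 => i _; apply: sumr_ge0 => j _; rewrite mulr_ge0.
rewrite qformE dotvE mulr_suml ler_sum // => i _.
rewrite mxE mulr_suml mulr_sumr ler_sum // => j _.
have hi := cP i z; have hj := cP j z; set q := qform M z in hi hj *.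
have h : `|z i 0 * z j 0| <= c * q.
  have := sqr_ge0 (z i 0 - z j 0); have := sqr_ge0 (z i 0 + z j 0).
  by rewrite ler_norml; move: hi hj; nra.
by rewrite mulrCA (le_trans (ler_norm _)) // normrM -mulrA ler_wpM2l //.
Qed.

End Dotv.

(** * Summable decreasing sequences *)

(** The bounds a_{k+1} <= E_k - E_{k+1} say that the sum of a is finite, with
    tails controlled by those of the convergent sequence E; a decreasing
    sequence then satisfies (n - N) a_n <= E_N - E_n, which is small for N
    large, uniformly in n. *)
Lemma dissipation_littleo (R : realType) (a E : nat -> R) :
  (forall k, 0 <= a k) -> (forall k, a k.+1 <= a k) -> (forall k, 0 <= E k) ->
  (forall k, a k.+1 <= E k - E k.+1) ->
  (a : nat -> R^o) =o_\oo (fun t : nat => t%:R^-1 : R^o).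
Proof.
move=> a0 aM E0 aE.
have sumE N j : j%:R * a (N + j)%N <= E N - E (N + j)%N.
  elim: j => [|j IH]; first by rewrite mul0r addn0 subrr.
  rewrite addnS -natr1 mulrDl mul1r.
  have h1 := aE (N + j)%N.
  have h2 : j%:R * a (N + j).+1 <= j%:R * a (N + j)%N by rewrite ler_wpM2l.
  lra.
apply/eqoP => eps eps0.
have [N EN] : exists N, forall n, E N - E n <= eps / 2.
  have hE : has_inf (range E).
    by split; [exists (E 0%N); exists 0%N|exists 0 => _ [k _ <-]].
  have [_ [N _ <-] HN] := inf_adherent (divr_gt0 eps0 (ltr0n _ 2)) hE.
  exists N => n; have : inf (range E) <= E n.
    by apply: ge_inf; [exact: hE.2|exists n].
  lra.
(* For n >= 2 N one has n <= 2 (n - N); the successor excludes n = 0. *)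
exists (N + N).+1 => //= n /= nN.
have n0 : 0 < n%:R :> R by rewrite ltr0n; case: n nN.
rewrite ger0_norm // ger0_norm ?invr_ge0 ?ler0n // ler_pdivlMr //.
have Nn : (N <= n)%N by rewrite (leq_trans _ nN) // -addnS leq_addr.
have := sumE N (n - N)%N; rewrite subnKC // => H; have H' := EN n.
have h : n%:R <= 2 * (n - N)%N%:R :> R.
  rewrite -natrM ler_nat mulnBr mul2n -addnn -addnBA; last first.
    by rewrite mul2n -addnn (leq_trans _ nN).
  by rewrite leq_addr.
have := ler_wpM2r (a0 n) h; lra.
Qed.

(** * Optimality conditions of the subproblems *)

(** Since theta is convex, moving from the minimiser x towards z by a fraction t
    costs theta at most t (theta z - theta x), while q changes by
    t <g, z - x> + O(t^2); divide by t and let t tend to 0. *)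
Lemma argmin_subdiff (R : realType) n (theta : 'cV[R]_n -> \bar R)
    (q Q : 'cV[R]_n -> R) (g x : 'cV[R]_n) :
  proper_fun theta -> convex_efun theta ->
  (forall d (t : R), q (x + t *: d) = q x + t * dotv g d + t ^+ 2 * Q d) ->
  argmin (fun z => (theta z + (q z)%:E)%E) x -> subdiff theta x (- g).
Proof.
move=> [Noo [z0 fz0]] cvx qE minx z.
have : (theta x < +oo)%E.
  have := minx z0; move: fz0; case: (theta z0) => //= r _.
  by case: (theta x) => [s| |] //; rewrite ?ltry.
have := Noo x; case tx : (theta x) => [a| |] // _ _.
have := Noo z; case tz : (theta z) => [c| |] // _; last by rewrite leey.
rewrite -EFinD lee_fin; set d := z - x.
have key t : 0 < t < 1 -> 0 <= c - a + dotv g d + t * Q d.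
  move=> t01; have t0 : 0 < t by case/andP: t01.
  have := minx (x + t *: d).
  have -> : x + t *: d = t *: z + (1 - t) *: x.
    by rewrite /d scalerBr scalerBl scale1r addrCA addrC.
  have := cvx z x t t01; rewrite tx tz /=.
  have -> : q (t *: z + (1 - t) *: x) = q x + t * dotv g d + t ^+ 2 * Q d.
    by rewrite -qE /d scalerBr scalerBl scale1r addrCA addrC.
  move: (theta _) => [s| |] //; rewrite -!EFinM -!EFinD !lee_fin => H1 H2.
  by rewrite -(pmulr_rge0 _ t0); lra.
have -> : dotv (- g) d = - dotv g d by rewrite /dotv linearN mulNmx mxE.
rewrite -subr_ge0 leNgt; apply/negP => neg.
set e := c - (a - dotv g d) in neg.
(* If e < 0, this fraction is so small that t * |Q d| < - e. *)
pose t := - e / (2 * (`|Q d| - e)).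
have den : 0 < 2 * (`|Q d| - e) by have := normr_ge0 (Q d); lra.
have t01 : 0 < t < 1.
  rewrite /t divr_gt0 ?oppr_gt0 //= ltr_pdivrMr // mul1r.
  by have := normr_ge0 (Q d); lra.
have := key t t01; have tE : t * (2 * (`|Q d| - e)) = - e.
  by rewrite /t divfK // gt_eqF.
have : t * Q d <= t * `|Q d| by rewrite ler_wpM2l ?ler_norm //; case/andP: t01 => /ltW.
have : 0 < t * - e by rewrite mulr_gt0 ?oppr_gt0 //; case/andP: t01.
rewrite /e in tE neg *; lra.
Qed.

Lemma composite_proper (R : realType) n (p : 'cV[R]_n -> \bar R) f :
  proper_fun p -> proper_fun (composite p f).
Proof.
move=> [pN [z fz]]; split=> [x|]; last first.
  by exists z; rewrite /composite; move: fz; case: (p z).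
by rewrite /composite; have := pN x; case: (p x).
Qed.

Lemma composite_convex (R : realType) n (p : 'cV[R]_n -> \bar R) f :
  proper_fun p -> convex_efun p ->
  convex_function (setT : set (convex_lmodType 'cV[R]_n)) f ->
  convex_efun (composite p f).
Proof.
move=> [pN _] cp cf x y t t01; rewrite /composite.
have [t0 t1] : 0 <= t /\ t <= 1 by case/andP: t01 => /ltW ? /ltW ?.
have := cp x y t t01.
have := cf (Itv01 t0 t1) x y (in_setT x) (in_setT y).
rewrite convRE /= => H1.
have {H1} : f (t *: x + (1 - t) *: y) <= t * f x + (1 - t) * f y by exact: H1.
have tp : 0 < t by case/andP: t01.
have t'p : 0 < 1 - t by case/andP: t01; rewrite subr_gt0.
have := pN x; have := pN y.
(* The right-hand side is +oo as soon as one endpoint is outside the domain. *)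
case: (p x) => [u| |] //; case: (p y) => [s| |] // _ _.
- have := pN (t *: x + (1 - t) *: y); case: (p (t *: x + _)) => [r| |] // _.
  by rewrite -!EFinM -!EFinD !lee_fin; lra.
- by move=> _ _; rewrite /= gt0_muley ?lte_fin // -EFinM addey ?leey.
- by move=> _ _; rewrite /= gt0_muley ?lte_fin // -EFinM addye ?leey.
- by move=> _ _; rewrite /= !gt0_muley ?lte_fin // addey ?leey.
Qed.

(** In both subproblems the objective is theta plus a quadratic in C z + c, with
    C = A or C = B and with the other block inside the offset c. *)
Lemma subproblem_subdiff (R : realType) n m (theta : 'cV[R]_n -> \bar R)
    (C : 'M[R]_(m, n)) (c l : 'cV[R]_m) (beta : R) (S : 'M[R]_n)
    (xk x : 'cV[R]_n) :
  proper_fun theta -> convex_efun theta -> symmx S ->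
  argmin (fun z => (theta z + (- dotv l (C *m z + c)
    + beta / 2 * dotv (C *m z + c) (C *m z + c)
    + 2^-1 * qform S (z - xk))%:E)%E) x ->
  subdiff theta x (C^T *m (l - beta *: (C *m x + c)) - S *m (x - xk)).
Proof.
move=> pth cth sS minx.
have -> : C^T *m (l - beta *: (C *m x + c)) - S *m (x - xk)
    = - (S *m (x - xk) - C^T *m (l - beta *: (C *m x + c))).
  by rewrite opprB.
apply: (argmin_subdiff (Q := fun d => beta / 2 * dotv (C *m d) (C *m d)
  + 2^-1 * qform S d) pth cth _ minx) => d t.
have -> : C *m (x + t *: d) + c = (C *m x + c) + t *: (C *m d).
  by rewrite mulmxDr -scalemxAr addrAC.
rewrite (addrAC x) (qformD _ (t *: d) sS) qformZ -scalemxAr.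
move: (C *m x + c) (x - xk) => r s; rewrite !dotv_lin.
rewrite (dotvC (S *m s)) (dotv_symm d s sS) -dotv_mulmx !dotv_lin.
by rewrite (dotvC (C *m d) r); field.
Qed.

(** * The energy inequality *)

Section Energy.
Context {R : realType} {n1 n2 m : nat}.
Context (A : 'M[R]_(m, n1)) (B : 'M[R]_(m, n2)) (beta alpha gamma : R).
Context (S Sigma1 : 'M[R]_n1) (T Sigma2 : 'M[R]_n2).

(** The quadratic form of Ghat in the variables (x, y, z) that diagonalise it,
    where z = l - alpha beta B y, see [qform_Ghat]. *)
Definition energy (x : 'cV[R]_n1) (y : 'cV[R]_n2) (z : 'cV[R]_m) : R :=
  qform (S + Sigma1) x + qform (T + Sigma2 + ((1 - alpha) * beta) *: (B^T *m B)) y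
  + ((alpha + gamma) * beta)^-1 * dotv z z.

Lemma qform_Ghat x y l : 0 < beta -> 0 < alpha + gamma ->
  qform (Ghat B beta alpha gamma S Sigma1 T Sigma2) (stack x y l)
  = energy x y (l - (alpha * beta) *: (B *m y)).
Proof.
move=> b0 ag0; rewrite /Ghat /stack /energy qformE.
rewrite !mul_block_col !mul0mx addr0 add0r.
have dot_col a c (u u' : 'cV[R]_a) (v v' : 'cV[R]_c) :
    dotv (col_mx u v) (col_mx u' v') = dotv u u' + dotv v v'.
  by rewrite /dotv tr_col_mx mul_row_col mxE.
rewrite !dot_col -!qformE mul_scalar_mx -!scalemxAl !dotv_lin -!qformE.
rewrite (dotv_mulmx B^T) trmxK (dotvC l (B *m y)) (dotvC (B *m y) l) !qform_lin.
by field; rewrite !gt_eqF.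
Qed.

(** The linear-algebra core.  Twice the sum of the hypotheses, polarised, gives
    the decrease of the energy without its Sigma1 and Sigma2 terms, plus
    2 |u'|^2_{Sigma1} + 2 |v'|^2_{Sigma2}.  Including these terms in the energy
    turns 2 |u'|^2 into |u|^2 + |u'|^2 = (|u - u'|^2 + |u + u'|^2) / 2, where the
    last square is dropped. *)
Lemma energy_decrease (u u' : 'cV[R]_n1) (v v' : 'cV[R]_n2) (z : 'cV[R]_m) :
  0 < beta -> 0 < alpha + gamma ->
  symmx S -> symmx T -> psdmx Sigma1 -> psdmx Sigma2 ->
  let l := z + (alpha * beta) *: (B *m v) in
  let r := A *m u' + B *m v' in let d := B *m (v - v') in
  qform Sigma1 u' <=
    dotv u' (A^T *m (l - beta *: (r + d)) - S *m (u' - u)) ->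
  qform Sigma2 v' <=
    dotv v' (B^T *m (l - (alpha * beta) *: (r + d) - beta *: r)
             - T *m (v' - v)) ->
  qform (S + 2^-1 *: Sigma1) (u - u') + qform (T + 2^-1 *: Sigma2) (v - v')
  + beta * ((1 - alpha) * dotv d d + 2 * (1 - alpha) * dotv r d
            + (2 - alpha - gamma) * dotv r r)
  <= energy u v z - energy u' v' (z - ((alpha + gamma) * beta) *: r).
Proof.
move=> b0 ag0 sS sT [sS1 pS1] [sS2 pS2] l r d Hx Hy.
have Ax : A *m u' = r - B *m v' by rewrite /r addrK.
have By : B *m v = d + B *m v' by rewrite /d mulmxBr subrK.
clearbody r d; have zz w : ((alpha + gamma) * beta)^-1 *
     dotv (z - ((alpha + gamma) * beta) *: w) (z - ((alpha + gamma) * beta) *: w)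
   = ((alpha + gamma) * beta)^-1 * dotv z z - 2 * dotv z w
     + (alpha + gamma) * beta * dotv w w.
  by rewrite !dotv_lin (dotvC w z); field; rewrite !gt_eqF.
move: Hx Hy (pS1 (u + u')) (pS2 (v + v')).
rewrite /energy zz !qform_lin !dotv_lin /l.
rewrite (dotv_mulmx A^T) (dotv_mulmx B^T) !trmxK Ax By.
rewrite !(qformD _ _ sS) !(qformD _ _ sS1) !(qformD _ _ sT) !(qformD _ _ sS2).
rewrite !qformN !mulmxN !mulmxDr !mulmxN !dotv_lin.
rewrite -!qformE (dotv_symm u' u) // (dotv_symm v' v) //.
rewrite (dotvC z r) (dotvC d (B *m v')) (dotvC (B *m v') r).
lra.
Qed.

(** One iteration in terms of its optimality conditions.  Primal-dual solutions are
    fixed points of this relation, so that errors w^k - w* and increments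
    w^k - w^{k+1} are both differences of two steps. *)
Definition prox_step (b : 'cV[R]_m) (theta1 : 'cV[R]_n1 -> \bar R)
    (theta2 : 'cV[R]_n2 -> \bar R)
    (x : 'cV[R]_n1) (y : 'cV[R]_n2) (l : 'cV[R]_m)
    (x' : 'cV[R]_n1) (y' : 'cV[R]_n2) (l' : 'cV[R]_m) : Prop :=
  let lhalf := l - (alpha * beta) *: residual A B b x' y in
  [/\ subdiff theta1 x'
         (A^T *m (l - beta *: residual A B b x' y) - S *m (x' - x)),
      subdiff theta2 y'
         (B^T *m (lhalf - beta *: residual A B b x' y') - T *m (y' - y))
    & l' = lhalf - (gamma * beta) *: residual A B b x' y'].

Lemma optimal_prox_step b theta1 theta2 x y l :
  primal_dual_optimal theta1 theta2 A B b x y l ->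
  prox_step b theta1 theta2 x y l x y l.
Proof.
move=> [feas sx sy]; rewrite /prox_step /residual feas subrr.
by rewrite !subrr !mulmx0 !scaler0 !subr0.
Qed.

(** Constants cancel in the difference of two steps, and monotonicity of the
    subdifferentials supplies the inequalities required by
    [energy_decrease]. *)
Lemma prox_step_decrease b theta1 theta2 x y l x' y' l' u v k u' v' k' :
  0 < beta -> 0 < alpha + gamma -> symmx S -> symmx T ->
  convexity_mx theta1 Sigma1 -> convexity_mx theta2 Sigma2 ->
  let dx := x - u in let dx' := x' - u' in
  let dy := y - v in let dy' := y' - v' in
  let r := residual A B b x' y' - residual A B b u' v' in
  let d := B *m (dy - dy') in
  prox_step b theta1 theta2 x y l x' y' l' ->
  prox_step b theta1 theta2 u v k u' v' k' ->
  qform (S + 2^-1 *: Sigma1) (dx - dx') + qform (T + 2^-1 *: Sigma2) (dy - dy')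
  + beta * ((1 - alpha) * dotv d d + 2 * (1 - alpha) * dotv r d
            + (2 - alpha - gamma) * dotv r r)
  <= energy dx dy (l - k - (alpha * beta) *: (B *m dy))
     - energy dx' dy' (l' - k' - (alpha * beta) *: (B *m dy')).
Proof.
move=> b0 ag0 sS sT [psd1 mono1] [psd2 mono2] dx dx' dy dy' r d.
move=> [sx sy ->] [su sv ->].
have resx : residual A B b x' y - residual A B b u' v = r + d.
  rewrite /r /d /dy /dy' /residual !mulmxBr !opprD !opprK.
  by apply/colP => i; rewrite !mxE; ring.
have rE : r = A *m dx' + B *m dy'.
  rewrite /r /dx' /dy' /residual !mulmxBr !opprD !opprK.
  by apply/colP => i; rewrite !mxE; ring.
set z := l - k - _.
have -> : l - (alpha * beta) *: residual A B b x' y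
    - (gamma * beta) *: residual A B b x' y'
    - (k - (alpha * beta) *: residual A B b u' v
    - (gamma * beta) *: residual A B b u' v') - (alpha * beta) *: (B *m dy')
    = z - ((alpha + gamma) * beta) *: r.
  rewrite /z; have -> : B *m dy = d + B *m dy' by rewrite /d (mulmxBr B dy dy') subrK.
  have -> : residual A B b x' y = residual A B b u' v + (r + d).
    by rewrite -resx subrKC.
  have -> : residual A B b x' y' = residual A B b u' v' + r.
    by rewrite /r subrKC.
  by apply/colP => i; rewrite !mxE; ring.
rewrite /d rE; apply: energy_decrease => //; rewrite -rE -/d.
- have := mono1 _ _ _ _ sx su; rewrite -/dx' => /le_trans; apply.
  rewrite le_eqVlt; apply/orP; left; apply/eqP; congr dotv.
  rewrite /z subrK -resx /dx /dx' !mulmxBr -!scalemxAr !mulmxBr.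
  by apply/colP => i; rewrite !mxE; ring.
- have := mono2 _ _ _ _ sy sv; rewrite -/dy' => /le_trans; apply.
  rewrite le_eqVlt; apply/orP; left; apply/eqP; congr dotv.
  rewrite /z subrK -resx /r /dy /dy' !mulmxBr -!scalemxAr !mulmxBr.
  by apply/colP => i; rewrite !mxE; ring.
Qed.

End Energy.

(** * Steps of the iteration *)

Section Iteration.
Context {R : realType} {n1 n2 m : nat}.
Context (A : 'M[R]_(m, n1)) (B : 'M[R]_(m, n2)) (b : 'cV[R]_m).
Context (beta alpha gamma : R).
Context (S : 'M[R]_n1) (T Sigma2 : 'M[R]_n2).
Context (theta1 : 'cV[R]_n1 -> \bar R) (theta2 : 'cV[R]_n2 -> \bar R).

Notation step := (prox_step A B beta alpha gamma S T b theta1 theta2).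

Lemma iPSPR_prox_step x y l k :
  proper_fun theta1 -> convex_efun theta1 ->
  proper_fun theta2 -> convex_efun theta2 -> symmx S -> symmx T ->
  iPSPR theta1 theta2 A B b beta alpha gamma S T x y l ->
  step (x k) (y k) (l k) (x k.+1) (y k.+1) (l k.+1).
Proof.
move=> p1 c1 p2 c2 sS sT /(_ k) /= [minx miny lE]; split=> //.
- rewrite /residual -addrA; apply: subproblem_subdiff => // z.
  have := minx z; rewrite /x_objective /coupling /residual.
  by rewrite -!(addrA (A *m _) (B *m _)).
- have resE z : residual A B b (x k.+1) z = B *m z + (A *m x k.+1 - b).
    by rewrite /residual addrAC addrC.
  rewrite [in X in beta *: X]resE; apply: subproblem_subdiff => // z.
  by have := miny z; rewrite /y_objective /coupling -!resE.
Qed.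

Lemma prox_step_multiplier x y l x' y' l' : step x y l x' y' l' ->
  l - l' - (alpha * beta) *: (B *m (y - y'))
  = ((alpha + gamma) * beta) *: residual A B b x' y'.
Proof.
move=> [_ _ ->]; have -> : residual A B b x' y =
    residual A B b x' y' + B *m (y - y').
  by rewrite /residual mulmxBr; apply/colP => i; rewrite !mxE; ring.
move: (residual _ _ _ _ _) (B *m _) => r d.
by apply/colP => i; rewrite !mxE; ring.
Qed.

(** When gamma = 1, the y-subgradient of each step is B^T l' - T (y' - y) with the
    final multiplier l', so two consecutive ones can be compared: monotonicity
    bounds <dy, B^T (l - l') + T dy0 - T dy> from below, and l - l' is a
    combination of r and B dy.  The products <dy, T dy0> are split by Young's
    inequality separately for T_+ and T_-, where T_- has the wrong sign and
    costs 2 |dy|^2_{T_-}. *)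
Lemma prox_step_cross_lb (Tplus Tminus : 'M[R]_n2) x0 y0 l0 x y l x' y' l' :
  T = Tplus - Tminus -> psdmx Tplus -> psdmx Tminus ->
  convexity_mx theta2 Sigma2 -> gamma = 1 ->
  step x0 y0 l0 x y l -> step x y l x' y' l' ->
  qform (- (2 *: Tminus) + Sigma2) (y - y')
  + 2^-1 * (qform (Tplus + Tminus) (y - y') - qform (Tplus + Tminus) (y0 - y))
  <= beta * ((1 + alpha) * dotv (residual A B b x' y') (B *m (y - y'))
             + alpha * dotv (B *m (y - y')) (B *m (y - y'))).
Proof.
move=> TE [sP pP] [sM pM] [_ mono] g1 s1 s2.
have := prox_step_multiplier s2; rewrite g1 => lE.
case: s1 => _ sy; rewrite g1 mul1r => l1.
case: s2 => _ sy'; rewrite g1 mul1r => l1'.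
move: sy sy' lE; rewrite -l1 -l1' => sy sy' lE {l1 l1'}.
have := mono _ _ _ _ sy sy'.
have -> : B^T *m l - T *m (y - y0) - (B^T *m l' - T *m (y' - y))
    = B^T *m (l - l') + T *m (y0 - y) - T *m (y - y').
  rewrite -(opprB y0 y) -(opprB y y') !mulmxN (mulmxBr B^T).
  by apply/colP => i; rewrite !mxE; ring.
have -> : l - l' = ((alpha + 1) * beta) *: residual A B b x' y'
    + (alpha * beta) *: (B *m (y - y')) by rewrite -lE subrK.
move: (residual _ _ _ _ _) (y - y') (y0 - y) => r d d0.
have h1 := pP (d - d0); have h2 := pM (d + d0).
move: h1 h2; rewrite (qformD _ _ sP) (qformD _ _ sM) qformN.
rewrite TE !qform_lin !mulmxBl !mulmxN !dotv_lin (dotv_mulmx B^T) trmxK.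
rewrite !dotv_lin -!qformE.
rewrite (dotvC (B *m d) r).
lra.
Qed.

End Iteration.

(** * Coercivity *)

(** For gamma = 1 the term with kappa1 removes half of the product <r, d>, so the
    minimum of the right-hand side over r is attained at r = - d / 2 and equals kappa2 / cag |d|^2; in the
    other cases kappa1 = 0 and the minimum over r is
    (1-alpha)(1-gamma)/(2-alpha-gamma) |d|^2, which is (1-alpha)/2 |d|^2 if
    alpha = gamma. *)
Lemma stepsize_coercive (R : realType) (cag alpha gamma : R) :
  D2 alpha gamma \/ D3 alpha gamma \/ D4 alpha gamma ->
  (D2 alpha gamma \/ D3 alpha gamma -> 0 < cag < 1) ->
  exists2 rho : R, 0 < rho & exists sigma : R, forall m (r d : 'cV[R]_m),
    kappa2 cag alpha gamma * dotv d d
      + rho * dotv (r + sigma *: d) (r + sigma *: d)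
    <= (1 - alpha) * dotv d d + 2 * (1 - alpha) * dotv r d
       + (2 - alpha - gamma) * dotv r r
       - kappa1 alpha gamma * ((1 + alpha) * dotv r d + alpha * dotv d d).
Proof.
move=> hD hcag; rewrite /kappa1 /kappa2; case: ifPn hD hcag.
  move=> D2h _ hc.
  have /andP[c0 c1] := hc (or_introl isT).
  case/andP: D2h => /andP[a0 a1] /eqP g1.
  exists (1 - alpha); first by lra.
  exists 2^-1 => m r d; rewrite !dotv_lin (dotvC d r) g1 -subr_ge0.
  set X := (X in 0 <= X).
  have -> : X = (1 - cag) * ((1 - alpha) * (3 - alpha) / (4 * (1 + alpha)))
                * dotv d d.
    by rewrite /X; field; rewrite gt_eqF //; lra.
  rewrite mulr_ge0 ?dotvv_ge0 // mulr_ge0 ?divr_ge0 ?mulr_ge0 //; lra.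
move=> nD2 [//|hD] hc.
have ag : 0 < 2 - alpha - gamma by case: hD => [/and4P[]|/andP[]] *; lra.
exists (2 - alpha - gamma) => //; exists ((1 - alpha) / (2 - alpha - gamma)).
move=> m r d; rewrite !dotv_lin (dotvC d r) mul0r subr0.
case: ifPn hD hc => [D3h _ hc|nD3 [//|]].
  have /andP[c0 c1] := hc (or_intror isT).
  case/and4P: D3h => /andP[a0 a1] /andP[g0 g1] _ _.
  rewrite -subr_ge0; set X := (X in 0 <= X).
  have -> : X = (1 - cag) * ((1 - alpha) * (1 - gamma) / (2 - alpha - gamma))
                * dotv d d.
    by rewrite /X; field; rewrite !gt_eqF //; lra.
  rewrite mulr_ge0 ?dotvv_ge0 // mulr_ge0 ?divr_ge0 ?mulr_ge0 //; lra.
case/andP => /andP[a0 a1] /eqP <- _.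
rewrite le_eqVlt; apply/orP; left; apply/eqP.
by field; rewrite gt_eqF //; lra.
Qed.

Lemma stepsize_nonneg (R : realType) (alpha gamma : R) m (r d : 'cV[R]_m) :
  0 < 2 - alpha - gamma ->
  (1 - alpha) * (1 - gamma) / (2 - alpha - gamma) * dotv d d
  <= (1 - alpha) * dotv d d + 2 * (1 - alpha) * dotv r d
       + (2 - alpha - gamma) * dotv r r.
Proof.
move=> ag; rewrite -subr_ge0; set X := (X in 0 <= X).
pose s := (1 - alpha) / (2 - alpha - gamma).
have -> : X = (2 - alpha - gamma) * dotv (r + s *: d) (r + s *: d).
  by rewrite /X /s !dotv_lin (dotvC d r); field; rewrite gt_eqF.
by rewrite mulr_ge0 ?dotvv_ge0 // ltW.
Qed.

(** The energy of an increment is bounded by the dissipation.  In x, the excess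
    Sigma1/2 is at most 1/c times S + Sigma1/2; the y part and |d|^2 are dominated
    by M, and then |r|^2 <= 2 |r + sigma d|^2 + 2 sigma^2 |d|^2. *)
Lemma energy_controlled (R : realType) (n1 n2 m : nat) (B : 'M[R]_(m, n2))
    (beta alpha gamma rho sigma c : R) (S Sigma1 : 'M[R]_n1)
    (T Sigma2 M : 'M[R]_n2) :
  0 < beta -> 0 < alpha + gamma -> 0 < rho -> 0 < c ->
  psdmx (S + 2^-1 *: Sigma1) ->
  psdmx (S + 2^-1 *: Sigma1 - (2^-1 * c) *: Sigma1) -> pdmx M ->
  exists2 K : R, 0 <= K & forall dx dy r,
    energy B beta alpha gamma S Sigma1 T Sigma2 dx dy
      (((alpha + gamma) * beta) *: r)
    <= K * (qform (S + 2^-1 *: Sigma1) dx + qform M dy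
            + beta * rho * dotv (r + sigma *: (B *m dy)) (r + sigma *: (B *m dy))).
Proof.
move=> b0 ag0 rho0 c0 [_ psd] [_ psdc] pdM.
have [C1 C10 C1P] := pdmx_dom (B^T *m B) pdM.
have [C2 C20 C2P] := pdmx_dom (T + Sigma2 + ((1 - alpha) * beta) *: (B^T *m B)) pdM.
pose K1 := 1 + c^-1; pose K2 := C2 + 2 * ((alpha + gamma) * beta) * sigma ^+ 2 * C1.
pose K3 := 2 * (alpha + gamma) / rho.
have K10 : 0 <= K1 by rewrite addr_ge0 // invr_ge0 ltW.
have agb : 0 <= (alpha + gamma) * beta by rewrite mulr_ge0 // ltW.
have K20 : 0 <= K2.
  apply: addr_ge0 => //; apply: mulr_ge0 => //.
  by apply: mulr_ge0; [exact: mulr_ge0|exact: sqr_ge0].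
have K30 : 0 <= K3 by rewrite divr_ge0 // ?mulr_ge0 // ltW.
exists (K1 + K2 + K3) => [|dx dy r]; first by lra.
set d := B *m dy.
set q1 := qform _ dx; set q2 := qform M dy; set w := r + sigma *: d.
have q10 : 0 <= q1 by exact: psd.
have q20 : 0 <= q2 by exact: pdmx_ge0.
have h1 : qform (S + Sigma1) dx <= K1 * q1.
  have := psdc dx; rewrite !qform_lin => H.
  rewrite /K1 mulrDl mul1r -lerBlDl mulrC ler_pdivlMr // /q1 !qform_lin.
  by have -> : qform S dx + qform Sigma1 dx - (qform S dx + 2^-1 * qform Sigma1 dx)
    = 2^-1 * qform Sigma1 dx; [field|lra].
have h2 := C2P dy; rewrite -/q2 in h2.
have h3 := C1P dy; rewrite qform_gram -/d -/q2 in h3.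
have h4 : ((alpha + gamma) * beta) * dotv r r
    <= 2 * ((alpha + gamma) * beta) * sigma ^+ 2 * C1 * q2
       + K3 * (beta * rho * dotv w w).
  have e : K3 * (beta * rho * dotv w w) = ((alpha + gamma) * beta) * (2 * dotv w w).
    by rewrite /K3; field; rewrite gt_eqF.
  have e2 : 2 * ((alpha + gamma) * beta) * sigma ^+ 2 * C1 * q2
      = ((alpha + gamma) * beta) * (2 * sigma ^+ 2 * (C1 * q2)) by ring.
  rewrite e e2 -mulrDr ler_wpM2l //.
  have s : sigma ^+ 2 * dotv d d <= sigma ^+ 2 * (C1 * q2).
    by rewrite ler_wpM2l ?sqr_ge0.
  have := dotvv_ge0 (r + (2 * sigma) *: d); rewrite /w !dotv_lin (dotvC d r).
  lra.
have w0 : 0 <= beta * rho * dotv w w by rewrite !mulr_ge0 ?dotvv_ge0 // ltW.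
rewrite /energy.
have -> : ((alpha + gamma) * beta)^-1 *
    dotv (((alpha + gamma) * beta) *: r) (((alpha + gamma) * beta) *: r)
    = ((alpha + gamma) * beta) * dotv r r.
  by rewrite !dotv_lin; field; rewrite !gt_eqF.
move: h1 h2 h4; set W := beta * rho * dotv w w => h1 h2 h4.
have : 0 <= (K1 + K3) * q2 + (K1 + K2) * W + (K2 + K3) * q1.
  by apply: addr_ge0; first apply: addr_ge0; apply: mulr_ge0 => //; lra.
rewrite /K2; lra.
Qed.

(** * The convergence rate *)

Theorem theorem4p2 (R : realType) (n1 n2 m : nat)
    (A : 'M[R]_(m, n1)) (B : 'M[R]_(m, n2)) (b : 'cV[R]_m)
    (p : 'cV[R]_n1 -> \bar R) (f : 'cV[R]_n1 -> R)
    (h : 'cV[R]_n2 -> \bar R) (g : 'cV[R]_n2 -> R)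
    (Sigma1 S : 'M[R]_n1) (Sigma2 T Tplus Tminus : 'M[R]_n2)
    (beta alpha gamma cag : R)
    (x : nat -> 'cV[R]_n1) (y : nat -> 'cV[R]_n2) (l : nat -> 'cV[R]_m)
    (hp : proper_closed_convex p) (hf : convex_lipschitz_grad f)
    (hh : proper_closed_convex h) (hg : convex_lipschitz_grad g)
    (hopt : exists xs ys ls,
       primal_dual_optimal (composite p f) (composite h g) A B b xs ys ls)
    (hSigma1 : convexity_mx (composite p f) Sigma1)
    (hSigma2 : convexity_mx (composite h g) Sigma2)
    (hbeta : 0 < beta)
    (hS : symmx S) (hT : symmx T)
    (hTdec : T = Tplus - Tminus)
    (hTplus : psdmx Tplus) (hTminus : psdmx Tminus)
    (hD : D2 alpha gamma \/ D3 alpha gamma \/ D4 alpha gamma)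
    (hcag : D2 alpha gamma \/ D3 alpha gamma -> 0 < cag < 1)
    (hw : iPSPR (composite p f) (composite h g) A B b beta alpha gamma S T
            x y l)
    (hS1 : psdmx (S + 2^-1 *: Sigma1))
    (hS2 : pdmx (S + 2^-1 *: Sigma1 + beta *: (A^T *m A)))
    (hS3 : exists2 c : R, 0 < c &
       psdmx (S + 2^-1 *: Sigma1 - (2^-1 * c) *: Sigma1))
    (hT1 : pdmx (T + Sigma2 + ((1 - alpha) * beta) *: (B^T *m B)))
    (hT2 : pdmx (T + 2^-1 *: Sigma2
                 + kappa1 alpha gamma *: (- (2 *: Tminus) + Sigma2)
                 + (kappa2 cag alpha gamma * beta) *: (B^T *m B)))
    (hT3 : psdmx (T + 2^-1 *: Sigma2
                  + ((1 - alpha) * (1 - gamma) / (2 - alpha - gamma) * beta)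
                    *: (B^T *m B))) :
  (fun t : nat =>
     qform (Ghat B beta alpha gamma S Sigma1 T Sigma2)
       (stack (x t) (y t) (l t) - stack (x t.+1) (y t.+1) (l t.+1)) : R^o)
  =o_\oo (fun t : nat => t%:R^-1 : R^o).
Proof.
have [ag0 ag2] : 0 < alpha + gamma /\ 0 < 2 - alpha - gamma.
  by case: hD => [/andP[/andP[? ?] /eqP ?]|[/and4P[/andP[? ?] /andP[? ?]]|
    /andP[/andP[? ?] /eqP ?]]] *; split; lra.
have [cvx1 pr1] : convex_efun (composite p f) /\ proper_fun (composite p f).
  have [pp _ cp] := hp; have [cf _ _] := hf.
  by split; [exact: composite_convex|exact: composite_proper].
have [cvx2 pr2] : convex_efun (composite h g) /\ proper_fun (composite h g).
  have [pp _ cp] := hh; have [cf _ _] := hg.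
  by split; [exact: composite_convex|exact: composite_proper].
have st k := iPSPR_prox_step k pr1 cvx1 pr2 cvx2 hS hT hw.
have [psdS _] := hSigma1.
pose V := energy B beta alpha gamma S Sigma1 T Sigma2.
have V0 u v z : 0 <= V u v z.
  have [_ pos1] := hS1; have [_ posS] := psdS.
  rewrite /V /energy !addr_ge0 //.
  - by have := pos1 u; have := posS u; rewrite !qform_lin; lra.
  - exact: pdmx_ge0.
  - by rewrite mulr_ge0 ?dotvv_ge0 // invr_ge0 mulr_ge0 // ltW.
pose dx k := x k - x k.+1; pose dy k := y k - y k.+1.
pose r k := residual A B b (x k.+1) (y k.+1).
pose a k := V (dx k) (dy k) (l k - l k.+1 - (alpha * beta) *: (B *m dy k)).
have -> : (fun t : nat => qform (Ghat B beta alpha gamma S Sigma1 T Sigma2)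
    (stack (x t) (y t) (l t) - stack (x t.+1) (y t.+1) (l t.+1))) = a.
  apply/funext => t; rewrite /stack !opp_col_mx !add_col_mx.
  exact: qform_Ghat.
have aE k : a k = V (dx k) (dy k) (((alpha + gamma) * beta) *: r k).
  by rewrite /a (prox_step_multiplier (st k)).
have aM k : a k.+1 <= a k.
  rewrite -subr_ge0.
  have := prox_step_decrease hbeta ag0 hS hT hSigma1 hSigma2 (st k) (st k.+1).
  apply: le_trans; rewrite -/(dx _) -/(dx _) -/(dy _) -/(dy _) -/(r _) -/(r _).
  set d := _ - dy k.+1; set e := _ - r k.+1.
  have [_ /(_ (dx k - dx k.+1)) H1] := hS1; have [_ /(_ d) H2] := hT3.
  have H3 := stepsize_nonneg e (B *m d) ag2.
  have := ler_wpM2l (ltW hbeta) H3; move: H2; rewrite qformDl qformZl qform_gram.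
  lra.
have [xs [ys [ls opt]]] := hopt; have sts := optimal_prox_step beta alpha gamma S T opt.
(* W is the squared distance to the solution; the potential E adds to it the
   telescoping term of [prox_step_cross_lb], present only when gamma = 1.  The
   index of W is shifted because that lemma compares two successive steps. *)
pose W k := V (x k - xs) (y k - ys) (l k - ls - (alpha * beta) *: (B *m (y k - ys))).
pose N k := qform (Tplus + Tminus) (dy k).
have N0 k : 0 <= N k.
  by have [_ P1] := hTplus; have [_ P2] := hTminus; rewrite /N qformDl addr_ge0.
have k10 : 0 <= kappa1 alpha gamma.
  by rewrite /kappa1; case: ifP => // /andP[/andP[? ?] _]; rewrite divr_ge0; lra.
have [rho rho0 [sigma sigmaP]] := stepsize_coercive hD hcag.
have [c c0 psdc] := hS3.
have [K K0 KP] := energy_controlled B sigma T Sigma2 hbeta ag0 rho0 c0 hS1 psdc hT2.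
pose E k := K * (W k.+1 + kappa1 alpha gamma / 2 * N k).
apply: (@dissipation_littleo _ a E) => // [k|k|k].
- exact: V0.
- by rewrite /E mulr_ge0 // addr_ge0 ?V0 // mulr_ge0 // divr_ge0.
rewrite aE /E -mulrBr (le_trans (KP _ _ _)) // ler_wpM2l //.
have := prox_step_decrease hbeta ag0 hS hT hSigma1 hSigma2 (st k.+1) sts.
have sub3 n (u v w : 'cV[R]_n) : u - w - (v - w) = u - v.
  by rewrite opprB addrA subrK.
have [feas _ _] := opt.
have -> : residual A B b xs ys = 0 by rewrite /residual feas subrr.
rewrite !sub3 subr0 -/(dx _) -/(dy _) -/(r _) -/V -/(W k.+1) -/(W k.+2).
set d := B *m dy k.+1 => dec.
have coer := ler_wpM2l (ltW hbeta) (sigmaP _ (r k.+1) d).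
have cross : kappa1 alpha gamma *
    (qform (- (2 *: Tminus) + Sigma2) (dy k.+1) + 2^-1 * (N k.+1 - N k))
    <= kappa1 alpha gamma *
    (beta * ((1 + alpha) * dotv (r k.+1) d + alpha * dotv d d)).
  have [D|nD] := boolP (D2 alpha gamma); last first.
    by rewrite /kappa1 (negPf nD) !mul0r.
  rewrite ler_wpM2l //; have /andP[_ /eqP g1] := D.
  exact: prox_step_cross_lb hTdec hTplus hTminus hSigma2 g1 (st k) (st k.+1).
rewrite (qformDl _ (_ *: (B^T *m B))) qformZl qform_gram -/d.
rewrite (qformDl _ (_ *: (- _ + _))) qformZl.
lra.
Qed.
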